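(* The optimal control of $(OCP)_\infty$ is given in feedback form by $$u_\infty(x)=-\left\lfloor\frac{\partial V_\infty}{\partial x_n}(x)\right\rceil^{\frac1{q-1}},$$ that is, for every $x_0\in\mathbb{R}^n$, the optimal control $u^\infty$ of $(OCP)_\infty$ starting from $x_0$ and the associated optimal trajectory $x^\infty$ satisfy $u^\infty(t)=u_\infty(x^\infty(t))$ for almost every $t\ge0$.
   Context: Let $n\ge 1$ be an integer and $q\in(1,\infty)$. $J_n$ is the $n\times n$ Jordan block with eigenvalue $0$ (ones on the superdiagonal, zeros elsewhere) and $e_n$ is the last canonical basis vector of $\mathbb{R}^n$. The control system is $\dot x=J_nx+e_nu$. The function $F:\mathbb{R}^n\to\mathbb{R}_{\ge 0}$ is continuously differentiable, convex and positive definite ($F(0)=0$, $F(x)>0$ for $x\ne0$). For $x_0\in\mathbb{R}^n$ and $u\in L^q(\mathbb{R}_{\ge0},\mathbb{R})$, $\mathcal{J}_\infty(x_0,u)=\int_0^\infty\left(\frac{|u(t)|^q}{q}+F(x(t))\right)dt$, where $x(\cdot)$ is the trajectory of the control system with $x(0)=x_0$ and control $u$; $V_\infty(x_0)=\inf_{u\in L^q(\mathbb{R}_{\ge0},\mathbb{R})}\mathcal{J}_\infty(x_0,u)$ is the value function (it is continuously differentiable on $\mathbb{R}^n$), and $(OCP)_\infty$ is the corresponding minimization problem, which has a unique minimizer (optimal control) for each $x_0$. For $a\in\mathbb{R}$ and $r>0$, $\lfloor a\rceil^r=|a|^r\,\mathrm{sgn}(a)$. *)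

(* Defs.v *)
From HB Require Import structures.
From mathcomp Require Import all_boot all_order all_algebra.
From mathcomp Require Import all_classical all_reals all_analysis.
Set Implicit Arguments.
Unset Strict Implicit.
Unset Printing Implicit Defensive.
Import Order.TTheory GRing.Theory Num.Theory.
Import numFieldNormedType.Exports.
Local Open Scope classical_set_scope.
Local Open Scope ring_scope.

Definition jordan_block0 (R : realType) (n : nat) : 'M[R]_n :=
  \matrix_(i < n, j < n) ((j : nat) == i.+1)%:R.

                                                                             
                             
Definition last_basis (R : realType) (n : nat) : 'cV[R]_n :=
  \col_(i < n) (i.+1 == n)%:R.

Definition signed_power (R : realType) (a r : R) : R := `|a| `^ r * Num.sg a.

                                                                              
                                             
Definition continuously_differentiable (R : realType) (n : nat)
    (f : 'cV[R]_n -> R^o) : Prop :=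
  (forall x, differentiable f x) /\
  (forall v, continuous (fun x => 'D_v f x)).

Definition positive_definite_fun (R : realType) (n : nat)
    (f : 'cV[R]_n -> R) : Prop :=
  f 0 = 0 /\ forall x, x != 0 -> 0 < f x.

                                                                               
                                                                      
Definition Lq_control (R : realType) (q : R) (u : R -> R) : Prop :=
  (u \_ `[0, +oo[ : measurableTypeR R -> R)
    \in Lfun (@lebesgue_measure R) q%:E.

                                                                          
                                                                             
                                                                          
                                     
Definition trajectory (R : realType) (n : nat) (x0 : 'cV[R]_n)
    (u : R -> R) (x : R -> 'cV[R]_n) : Prop :=
  {within `[0, +oo[, continuous x} /\
  forall t : R, 0 <= t -> forall i : 'I_n,
    x t i 0 = x0 i 0 +
      \int[@lebesgue_measure R]_(s in `[0, t])
        (jordan_block0 R n *m x s + u s *: last_basis R n) i 0.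

Definition admissible (R : realType) (n : nat) (q : R) (x0 : 'cV[R]_n)
    (u : R -> R) (x : R -> 'cV[R]_n) : Prop :=
  Lq_control q u /\ trajectory x0 u x.

                                                                    
Definition cost (R : realType) (n : nat) (q : R) (F : 'cV[R]_n -> R)
    (u : R -> R) (x : R -> 'cV[R]_n) : \bar R :=
  (\int[@lebesgue_measure R]_(t in `[0%R, +oo[)
     (`|u t| `^ q / q + F (x t))%:E)%E.

                                                                             
                                
Definition value_function (R : realType) (n : nat) (q : R)
    (F : 'cV[R]_n -> R) (x0 : 'cV[R]_n) : R^o :=
  fine (ereal_inf [set c : \bar R |
    exists u x, admissible q x0 u x /\ c = cost q F u x]).

Definition optimal (R : realType) (n : nat) (q : R) (F : 'cV[R]_n -> R)
    (x0 : 'cV[R]_n) (u : R -> R) (x : R -> 'cV[R]_n) : Prop :=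
  admissible q x0 u x /\
  forall u' x', admissible q x0 u' x' -> (cost q F u x <= cost q F u' x')%E.

Definition optimal_feedback (R : realType) (n : nat) (q : R)
    (F : 'cV[R]_n -> R) (x : 'cV[R]_n) : R :=
  - signed_power ('D_(last_basis R n) (value_function q F) x) (q - 1)^-1.

(* Main.v *)
(* Let (u, x) be optimal from x0. By Bellman's principle the tail of (u, x) at
   time t is optimal from x t. Add h times a control that steers the state from
   e_n to 0 in time e, i.e. start from x t + h e_n and rejoin x at time t + e.
   As h -> 0 and then e -> 0, the cost increases by at most
   - h [u t]^(q-1) + o(h) whenever t is a Lebesgue point of [u]^(q-1), because
   the steering control has integral -1 and is of size 1/e while the
   perturbation of the state stays bounded. Since V is convex, this one-sided
   estimate for both signs of h forces V to be differentiable at x t in the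
   direction e_n, with derivative - [u t]^(q-1); inverting the power gives the
   feedback law. *)
Require Import Defs.
From HB Require Import structures.
From mathcomp Require Import all_boot all_order all_algebra.
From mathcomp Require Import all_classical all_reals all_analysis.
From mathcomp Require Import measurable_realfun ring lra.
Import Order.TTheory GRing.Theory Num.Theory.
Import numFieldNormedType.Exports.
Local Open Scope classical_set_scope.
Local Open Scope ring_scope.
Set Implicit Arguments.
Unset Strict Implicit.
Unset Printing Implicit Defensive.

(** * Translation invariance of the Lebesgue integral *)

(** The obstacle is that [u] is merely in $L^q$, hence possibly unbounded. Expanding $|u+hw|^q/q$ to
    first order requires a modulus of continuity of $\lfloor\cdot\rceil^{q-1}$ valid for all values
    of [u] at once; it exists relative to $1+|u|^{q-1}$, which is locally integrable. The
    first-order error is then $1/e$ times the integral over $[0,e]$ of the deviation of $\lfloor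
    u\rceil^{q-1}$ from its value at the base point, and this is what a Lebesgue point controls. The
    order of the limits is forced: the control perturbation is of size $|h|/e$, so [h] can only be
    chosen after [e]. The state term of the cost is estimated along chords of the convex function
    [F], which gives $|h|$ times a constant times [e]. *)

Lemma shift_preimage_itv (R : realType) (t : R) (b1 b2 : bool) (c d : R) :
  (fun s => s + t) @^-1` [set` Interval (BSide b1 c) (BSide b2 d)] =
  [set` Interval (BSide b1 (c - t)) (BSide b2 (d - t))].
Proof.
by apply/seteqP; split => s /=; rewrite !in_itv/=; case: b1; case: b2;
  rewrite /= ?lerBlDr ?ltrBlDr ?lerBrDr ?ltrBrDr.
Qed.

Lemma shift_preimage_itvy (R : realType) (t : R) (b1 : bool) (c : R) :
  (fun s => s + t) @^-1` [set` Interval (BSide b1 c) +oo%O] =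
  [set` Interval (BSide b1 (c - t)) +oo%O].
Proof.
by apply/seteqP; split => s /=; rewrite !in_itv/=; case: b1;
  rewrite /= ?lerBlDr ?ltrBlDr.
Qed.

Section shift.
Context {R : realType}.
Notation mu := (@lebesgue_measure R).

Lemma measurable_shift (t : R) :
  measurable_fun [set: measurableTypeR R]
    (fun s : R => s + t : measurableTypeR R).
Proof. by apply: measurable_funD. Qed.

(** The pushforward by a translation agrees with Lebesgue measure on half-open intervals, which
    determine it. *)
Lemma lebesgue_measure_shift (t : R) (A : set R) : measurable A ->
  mu ((fun s : R => s + t) @^-1` A) = mu A.
Proof.
move=> mA; apply/esym.
rewrite -[RHS]/(pushforward mu (fun s : R => s + t : measurableTypeR R) A).
have mphi := measurable_shift t.
apply: (@lebesgue_measure_unique _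
  (pushforward mu (fun s : R => s + t : measurableTypeR R))) => //=.
move=> _ [[a b]] _ <-.
rewrite /pushforward shift_preimage_itv !lebesgue_measure_itv/=.
rewrite !lte_fin ltrD2r; case: ifP => // _.
by rewrite -!EFinB; congr (_%:E); ring.
Qed.

(** Changing variables separately in the positive and negative parts requires only measurability, so
    the formula also applies to costs that may be infinite. *)
Lemma integral_shift (t : R) (D : set R) (f : R -> \bar R) :
  measurable D -> measurable_fun D f ->
  (\int[mu]_(s in D) f s =
   \int[mu]_(s in (fun s => s + t)%R @^-1` D) f (s + t)%R)%E.
Proof.
move=> mD mf.
have ge0 g : measurable_fun D g -> {in D, forall y, 0 <= g y}%E ->
    (\int[mu]_(s in D) g s =
     \int[mu]_(s in (fun s => s + t)%R @^-1` D) g (s + t)%R)%E.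
  move=> mg g0.
  rewrite -(ge0_integral_pushforward (measurable_shift t)) //.
  apply: eq_measure_integral => //=; first exact: measurable_shift.
  by move=> mphi A mA AS; apply/esym; exact: lebesgue_measure_shift.
rewrite integralE [RHS]integralE; congr (_ - _)%E.
- rewrite ge0; last by move=> y _; exact: funepos_ge0.
    by apply: eq_integral => s _; rewrite !funeposE.
  exact: measurable_funepos.
- rewrite ge0; last by move=> y _; exact: funeneg_ge0.
    by apply: eq_integral => s _; rewrite !funenegE.
  exact: measurable_funeneg.
Qed.

Lemma measurable_fun_shift (t : R) d (T : measurableType d) (D : set R)
    (f : R -> T) :
  measurable D -> measurable_fun D f ->
  measurable_fun ((fun s => s + t) @^-1` D) (fun s => f (s + t)).
Proof.
move=> mD mf.
apply: (measurable_comp mD _ mf); first by move=> _ [s Ds <-].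
exact: measurable_funTS (measurable_shift t).
Qed.

Lemma integrable_shift (t : R) (D : set R) (f : R -> \bar R) :
  measurable D -> mu.-integrable D f ->
  mu.-integrable ((fun s => s + t) @^-1` D) (fun s => f (s + t)).
Proof.
move=> mD /integrableP[mf fi]; apply/integrableP; split.
  exact: measurable_fun_shift.
move: fi; rewrite (integral_shift t mD)//.
by apply: measurableT_comp.
Qed.

End shift.

(** * Trajectories of the integrator chain *)

Section trajectories.
Context {R : realType}.
Notation mu := (@lebesgue_measure R).

(** The working class of controls: it makes the integral equation linear and additive over
    intervals, and membership in $L^q$ is recovered afterwards from finiteness of the cost. For
    negative [t] the interval is empty. *)
Definition locally_integrable_control (f : R -> R) : Prop :=
  forall t, mu.-integrable `[0, t] (EFin \o f).

Lemma continuous_locally_integrable_control (f : R -> R) :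
  {within `[0, +oo[, continuous f} -> locally_integrable_control f.
Proof.
move=> fc t; apply: continuous_compact_integrable; first exact: segment_compact.
apply: continuous_subspaceW fc => s /=; rewrite !in_itv/= andbT.
by case/andP.
Qed.

Lemma locally_integrable_control_cst (c : R) :
  locally_integrable_control (fun=> c).
Proof.
apply/continuous_locally_integrable_control/continuous_subspaceT => s.
exact: cst_continuous.
Qed.

Lemma locally_integrable_control_linear (a b : R) (f g : R -> R) :
  locally_integrable_control f -> locally_integrable_control g ->
  locally_integrable_control (fun s => a * f s + b * g s).
Proof.
move=> fi gi t; apply: (@integrableD _ _ _ mu _ _
  (fun s => (a * f s)%:E) (fun s => (b * g s)%:E)) => //.
  exact: (integrableZl _ _ (fi t)).
exact: (integrableZl _ _ (gi t)).
Qed.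

Lemma coord_within_continuous n (A : set R) (x : R -> 'cV[R]_n) i :
  {within A, continuous x} -> {within A, continuous (fun s => x s i 0)}.
Proof.
move=> xc s; apply: (cvg_comp _ (fun M : 'cV[R]_n => M i 0) (xc s)).
exact: coord_continuous.
Qed.

Lemma scale_within_continuous n (a : R) (A : set R) (x : R -> 'cV[R]_n) :
  {within A, continuous x} -> {within A, continuous (fun s => a *: x s)}.
Proof.
move=> xc s; apply: (cvg_comp _ (fun M : 'cV[R]_n => a *: M) (xc s)).
exact: scaler_continuous.
Qed.

Section rhs.
Variables (n : nat).
Implicit Types (x : 'cV[R]_n) (u : R) (i j : 'I_n).

(** The vector field of the control system. Each coordinate is the next state coordinate, except the
    last, which is the control; coordinatewise arguments split along [next_or_last]. *)
Definition rhs x u : 'cV[R]_n := jordan_block0 R n *m x + u *: last_basis R n.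

Lemma rhs_next x u i j : j = i.+1 :> nat -> rhs x u i 0 = x j 0.
Proof.
move=> ji; rewrite !mxE (bigD1 j)//= !mxE ji eqxx mul1r big1 => [|k kj].
  by rewrite -ji (ltn_eqF (ltn_ord j)) mulr0 !addr0.
rewrite !mxE -ji; case: eqP => [/val_inj kjE|_]; last by rewrite mul0r.
by rewrite kjE eqxx in kj.
Qed.

Lemma rhs_last x u i : i.+1 = n -> rhs x u i 0 = u.
Proof.
move=> iN; rewrite !mxE big1 => [|k _].
  by rewrite iN eqxx mulr1 add0r.
by rewrite !mxE iN (ltn_eqF (ltn_ord k)) mul0r.
Qed.

Lemma next_or_last i : (exists j, j = i.+1 :> nat) \/ i.+1 = n.
Proof.
have := ltn_ord i; rewrite leq_eqVlt => /predU1P[->|ltin]; first by right.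
by left; exists (Ordinal ltin).
Qed.

Lemma rhs_linear (a b : R) x y u v i :
  rhs (a *: x + b *: y) (a * u + b * v) i 0 =
  a * rhs x u i 0 + b * rhs y v i 0.
Proof.
case: (next_or_last i) => [[j ji]|iN]; last by rewrite !rhs_last.
by rewrite !(rhs_next _ _ ji) !mxE.
Qed.

End rhs.

Lemma rhs_locally_integrable n (x : R -> 'cV[R]_n) (u : R -> R) i :
  {within `[0, +oo[, continuous x} -> locally_integrable_control u ->
  locally_integrable_control (fun s => rhs (x s) (u s) i 0).
Proof.
move=> xc ui; case: (next_or_last i) => [[j ji]|iN].
  rewrite (_ : (fun s => _) = (fun s => x s j 0)).
    exact/continuous_locally_integrable_control/coord_within_continuous.
  by apply/funext => s; rewrite (rhs_next _ _ ji).
rewrite (_ : (fun s => _) = u)//.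
by apply/funext => s; rewrite rhs_last.
Qed.

Lemma trajectory_linear n (a b : R) (x0 y0 : 'cV[R]_n) u v x y :
  locally_integrable_control u -> locally_integrable_control v ->
  trajectory x0 u x -> trajectory y0 v y ->
  trajectory (a *: x0 + b *: y0) (fun s => a * u s + b * v s)
    (fun s => a *: x s + b *: y s).
Proof.
move=> ui vi [xc xE] [yc yE]; split.
  have cx : {within `[0, +oo[, continuous (fun s => a *: x s)}.
    exact: scale_within_continuous.
  have cy : {within `[0, +oo[, continuous (fun s => b *: y s)}.
    exact: scale_within_continuous.
  by move=> s; exact: cvgD (cx s) (cy s).
move=> t t0 i.
under eq_Rintegral do rewrite -/(rhs _ _) rhs_linear.
have xi := rhs_locally_integrable i xc ui t.
have yi := rhs_locally_integrable i yc vi t.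
rewrite RintegralD//; last 2 first.
- exact: (integrableZl _ a xi).
- exact: (integrableZl _ b yi).
rewrite !RintegralZl// !mxE xE// yE//.
by rewrite /rhs; ring.
Qed.

Lemma itv_shift_split (f : R -> R) (t s : R) : 0 <= t -> 0 <= s ->
  locally_integrable_control f ->
  \int[mu]_(r in `[0, t + s]) f r =
  \int[mu]_(r in `[0, t]) f r + \int[mu]_(r in `[0, s]) f (r + t).
Proof.
move=> t0 s0 fi; rewrite [RHS]addrC; apply/eqP; rewrite -subr_eq; apply/eqP.
rewrite Rintegral_itvB ?bnd_simp ?lerDl//.
rewrite Rintegral_itv_obnd_cbnd; last first.
  apply: integrableS (fi (t + s)) => //.
  by move=> r /=; rewrite !in_itv/= => /andP[/ltW tr ->]; rewrite (le_trans t0).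
rewrite /Rintegral; congr fine.
rewrite (integral_shift t)//; last first.
  apply: measurable_funS (measurable_int _ (fi (t + s))) => //.
  by move=> r /=; rewrite !in_itv/= => /andP[tr ->]; rewrite (le_trans t0).
by rewrite shift_preimage_itv subrr addrAC subrr add0r.
Qed.

End trajectories.

(** * Time shift and concatenation of controls and trajectories *)

Section pasting.
Context {R : realType}.
Notation mu := (@lebesgue_measure R).

Lemma integrable_setU (A B : set R) (f : R -> \bar R) :
  measurable A -> measurable B -> [disjoint A & B] ->
  mu.-integrable A f -> mu.-integrable B f -> mu.-integrable (A `|` B) f.
Proof.
move=> mA mB dAB /integrableP[mfA fA] /integrableP[mfB fB].
have mf : measurable_fun (A `|` B) f by apply/measurable_funU.
apply/integrableP; split => //.
rewrite ge0_integral_setU//; last exact: measurableT_comp.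
by rewrite lte_add_pinfty.
Qed.

Lemma eq_integrable_on (D : set R) (f g : R -> R) : measurable D ->
  (forall s, D s -> f s = g s) ->
  mu.-integrable D (EFin \o f) -> mu.-integrable D (EFin \o g).
Proof.
move=> mD fg; apply: (@eq_integrable _ _ _ mu D mD (EFin \o f)) => s.
by rewrite inE /= => /fg ->.
Qed.

Lemma within_continuous_shift (T : topologicalType) (t : R) (A B : set R)
    (x : R -> T) :
  (forall s, B s -> A (s + t)) ->
  {within A, continuous x} -> {within B, continuous (fun s => x (s + t))}.
Proof.
move=> BA /subspace_continuousP xc; apply/subspace_continuousP => s Bs.
apply: cvg_comp (xc _ (BA _ Bs)) => P /=.
rewrite /within/= => AP.
have ct : (fun r => r + t) @ nbhs s --> s + t.
  by apply: cvgD; [exact: cvg_id|exact: cvg_cst].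
have H : nbhs s [set r | A (r + t) -> P (r + t)] := ct _ AP.
apply: (@filterS _ (nbhs s) _ [set r | A (r + t) -> P (r + t)]) => // r Pr.
by move=> /BA/Pr.
Qed.

Lemma locally_integrable_control_shift (t : R) (f : R -> R) : 0 <= t ->
  locally_integrable_control f ->
  locally_integrable_control (fun s => f (s + t)).
Proof.
move=> t0 fi b.
have : mu.-integrable `[t, b + t] (EFin \o f).
  apply: integrableS (fi (b + t)) => // s /=; rewrite !in_itv/= => /andP[ts ->].
  by rewrite (le_trans t0).
by move/(integrable_shift t); rewrite shift_preimage_itv subrr addrK; apply.
Qed.

Lemma trajectory_shift n (x0 : 'cV[R]_n) u x (t : R) :
  0 <= t -> locally_integrable_control u -> trajectory x0 u x ->
  trajectory (x t) (fun s => u (s + t)) (fun s => x (s + t)).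
Proof.
move=> t0 ui [xc xE]; split.
  apply: within_continuous_shift xc => s /=.
  by rewrite !in_itv/= !andbT => s0; rewrite addr_ge0.
move=> s s0 i; rewrite addrC !xE ?addr_ge0//.
by rewrite itv_shift_split// ?addrA//; exact: rhs_locally_integrable.
Qed.

(** The value at the junction [s = t] is [g 0]. For states it will agree with [f t]; for controls it
    only affects a null set. *)
Definition paste (T : Type) (t : R) (f g : R -> T) (s : R) :=
  if s < t then f s else g (s - t).

Lemma paste_lt T (t : R) (f g : R -> T) s : s < t -> paste t f g s = f s.
Proof. by rewrite /paste => ->. Qed.

Lemma paste_ge T (t : R) (f g : R -> T) s : t <= s -> paste t f g s = g (s - t).
Proof. by rewrite /paste leNgt; case: ltP. Qed.

Lemma paste_shift T (t : R) (f g : R -> T) s : 0 <= s ->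
  paste t f g (s + t) = g s.
Proof. by move=> s0; rewrite paste_ge ?lerDr// addrK. Qed.

Lemma locally_integrable_control_paste (t : R) (f g : R -> R) : 0 <= t ->
  locally_integrable_control f -> locally_integrable_control g ->
  locally_integrable_control (paste t f g).
Proof.
move=> t0 fi gi b.
have : mu.-integrable (`[0, t[ `|` `[t, Num.max t b]) (EFin \o paste t f g).
  apply: integrable_setU => //.
  - apply/disj_setPS => s /= [].
    by rewrite !in_itv/= => /andP[_ st] /andP[]; rewrite leNgt st.
  - apply: (@eq_integrable_on _ f) => //.
      move=> s /=; rewrite in_itv/= => /andP[_ st].
      by rewrite paste_lt.
    apply: integrableS (fi t) => // s /=; rewrite !in_itv/= => /andP[-> /ltW].
    by [].
  - apply: (@eq_integrable_on _ (fun s => g (s - t))) => //.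
      move=> s /=; rewrite in_itv/= => /andP[ts _].
      by rewrite paste_ge.
    have := integrable_shift (- t) (measurable_itv _) (gi (Num.max t b - t)).
    by rewrite shift_preimage_itv opprK add0r subrK.
apply: integrableS => //.
  by apply: measurableU.
move=> s /=; rewrite !in_itv/= => /andP[-> sb].
by have [st|ts] := ltP s t; [left|right]; rewrite // le_max sb orbT.
Qed.

Lemma trajectory_start n (x0 : 'cV[R]_n) u x : trajectory x0 u x -> x 0 = x0.
Proof.
move=> [_ xE]; apply/matrixP => i j; rewrite ord1 xE// set_itv1.
by rewrite Rintegral_set1 addr0.
Qed.

Lemma within_continuous_paste (T : topologicalType) (t : R) (x y : R -> T) :
  0 <= t -> x t = y 0 ->
  {within `[0, +oo[, continuous x} -> {within `[0, +oo[, continuous y} ->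
  {within `[0, +oo[, continuous (paste t x y)}.
Proof.
move=> t0 xy xc yc.
(* Gluing over a closed cover: [x t = y 0] makes the pasted map equal to [x] on the whole of
   [[0, t]], endpoint included. *)
apply: (@continuous_subspaceW _ _ _ (`[0, t] `|` `[t, +oo[)).
  move=> s /=; rewrite !in_itv/= !andbT => ->.
  by have [/ltW st|ts] := ltP s t; [left|right].
apply: withinU_continuous; first exact: interval_closed.
- exact: interval_closed.
- apply: (@subspace_eq_continuous _ _ _ x).
    move=> s; rewrite inE/= in_itv/= => /andP[s0]; rewrite le_eqVlt.
    rewrite [RHS]/(paste t x y s) /paste => /predU1P[->|->//].
    by rewrite ltxx subrr.
  apply: continuous_subspaceW xc => s /=.
  by rewrite !in_itv/= => /andP[->].
- apply: (@subspace_eq_continuous _ _ _ (fun s => y (s - t))).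
    move=> s; rewrite inE/= in_itv/= andbT => ts.
    by apply/esym; exact: paste_ge.
  apply: within_continuous_shift yc => s /=.
  by rewrite !in_itv/= !andbT subr_ge0.
Qed.

Lemma trajectory_paste n (x0 : 'cV[R]_n) u v x y (t : R) :
  0 <= t -> locally_integrable_control u -> locally_integrable_control v ->
  trajectory x0 u x -> trajectory (x t) v y ->
  trajectory x0 (paste t u v) (paste t x y).
Proof.
move=> t0 ui vi xT yT; have xc := xT.1; have yc := yT.1.
have xE := xT.2; have yE := yT.2.
have pc : {within `[0, +oo[, continuous (paste t x y)}.
  by apply: within_continuous_paste => //; rewrite (trajectory_start yT).
split => // s s0 i.
have pi : locally_integrable_control
    (fun r => rhs (paste t x y r) (paste t u v r) i 0).
  apply: rhs_locally_integrable => //.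
  exact: locally_integrable_control_paste.
have [st|ts] := ltP s t.
  rewrite paste_lt// xE//; congr (_ + _); apply: eq_Rintegral => r.
  rewrite inE/= in_itv/= => /andP[_ rs].
  by rewrite !paste_lt// (le_lt_trans rs).
rewrite paste_ge// yE ?subr_ge0// xE// -addrA; congr (_ + _).
have st0 : 0 <= s - t by rewrite subr_ge0.
have := itv_shift_split t0 st0 pi; rewrite [t + _]addrC subrK => ->.
congr (_ + _).
  (* At [r = t] the pasted control is [v 0] instead of [u t], so the integrands are compared only in
     the interior of the interval. *)
  rewrite /Rintegral; congr fine; apply: eq_integral_itv_bounded.
  - have ri := rhs_locally_integrable i xc ui t.
    apply/measurable_EFinP/measurable_funS; last exact: (measurable_int _ ri).
      by [].
    by apply: subset_itv; rewrite bnd_simp.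
  - have rpi := pi t.
    apply/measurable_EFinP/measurable_funS; last exact: (measurable_int _ rpi).
      by [].
    by apply: subset_itv; rewrite bnd_simp.
  - by move=> r; rewrite in_itv/= => /andP[_ rt]; rewrite !paste_lt.
apply: eq_Rintegral => r.
by rewrite inE/= in_itv/= => /andP[r0 _]; rewrite !paste_shift.
Qed.

End pasting.

(** * Steering by polynomials *)

Section polynomials.
Context {R : realType}.
Notation mu := (@lebesgue_measure R).

Lemma Rintegral_deriv_poly (p : {poly R}) (t : R) : 0 <= t ->
  \int[mu]_(s in `[0, t]) (p^`()).[s] = p.[t] - p.[0].
Proof.
rewrite le_eqVlt => /predU1P[<-|t0].
  by rewrite set_itv1 Rintegral_set1 subrr.
rewrite /Rintegral (@continuous_FTC2 _ _ (horner p))//.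
- by apply: continuous_subspaceT; exact: continuous_horner.
- split.
  + by move=> s _; exact: derivable_horner.
  + by apply: cvg_at_right_filter; exact: continuous_horner.
  + by apply: cvg_at_left_filter; exact: continuous_horner.
- by move=> s _; rewrite derivE.
Qed.

Lemma continuous_col (T : topologicalType) n (f : 'I_n -> T -> R) :
  (forall i, continuous (f i)) ->
  continuous (fun s => \col_i f i s : 'cV[R]_n).
Proof.
move=> fc s.
have -> : (fun s => \col_i f i s : 'cV[R]_n) =
          (fun s => \sum_(i < n) f i s *: delta_mx i 0).
  apply/funext => r; apply/matrixP => i j; rewrite ord1 summxE mxE (bigD1 i)//=.
  rewrite !mxE !eqxx mulr1 big1 ?addr0// => k ki.
  by rewrite !mxE eq_sym (negbTE ki) mulr0.
apply: continuous_big => // [|i _ r].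
  exact: add_continuous.
by apply: cvgZr_tmp; exact: fc.
Qed.

(** Flatness of the integrator chain: once the first coordinate is chosen to be [p], the other
    states are its successive derivatives and the control is the derivative of order [n]. *)
Lemma trajectory_poly n (p : {poly R}) :
  trajectory (\col_(i < n) (p^`(i)).[0]) (fun s => (p^`(n)).[s])
    (fun s => \col_(i < n) (p^`(i)).[s]).
Proof.
split.
  apply: continuous_subspaceT; apply: continuous_col => i.
  exact: continuous_horner.
move=> t t0 i; rewrite !mxE.
under eq_Rintegral => s _.
  rewrite -/(rhs _ _) (_ : rhs _ _ i 0 = (p^`(i.+1)).[s]); first over.
  case: (next_or_last i) => [[j ji]|iN].
    by rewrite (rhs_next _ _ ji) mxE ji.
  by rewrite rhs_last// iN.
rewrite derivnS Rintegral_deriv_poly//.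
by rewrite addrC subrK.
Qed.

Lemma locally_integrable_control_poly (p : {poly R}) :
  locally_integrable_control (horner p).
Proof.
apply/continuous_locally_integrable_control/continuous_subspaceT.
exact: continuous_horner.
Qed.

Lemma trajectory0 n : trajectory 0 (fun=> 0) (fun=> 0 : 'cV[R]_n).
Proof.
have := @trajectory_poly n 0.
have -> : \col_(i < n) ((0 : {poly R})^`(i)).[0] = 0 :> 'cV[R]_n.
  by apply/matrixP => i j; rewrite !mxE linear0 horner0.
rewrite (_ : (fun s => _) = (fun=> 0)); last first.
  by apply/funext => s; rewrite linear0 horner0.
rewrite (_ : (fun s => \col_i _) = (fun=> 0))//.
by apply/funext => s; apply/matrixP => i j; rewrite !mxE linear0 horner0.
Qed.

(** Each differentiation consumes a single factor ['X - a%:P], so a root of multiplicity [n]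
    annihilates all derivatives of order below [n]. *)
Lemma derivn_mulXsubX (a : R) (i m : nat) (q : {poly R}) : exists r,
  (('X - a%:P) ^+ (m + i) * q)^`(i) = ('X - a%:P) ^+ m * r.
Proof.
elim: i m q => [|i IH] m q; first by exists q; rewrite addn0.
rewrite derivSn.
have -> : (('X - a%:P) ^+ (m + i.+1) * q)^`() =
    ('X - a%:P) ^+ (m + i) * (q *+ (m + i).+1 + ('X - a%:P) * q^`()).
  by rewrite derivM addnS deriv_exp derivXsubC mul1r -pred_Sn exprSr; ring.
exact: IH.
Qed.

Lemma derivn_mulXsub_root (a : R) (i n : nat) (q : {poly R}) : (i < n)%N ->
  ((('X - a%:P) ^+ n * q)^`(i)).[a] = 0.
Proof.
move=> ltin; have -> : n = ((n - i.+1).+1 + i)%N by rewrite addSnnS subnK.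
have [r ->] := derivn_mulXsubX a i (n - i.+1).+1 q.
by rewrite exprS !hornerE subrr !mul0r.
Qed.

(* Multiplying by [(1 - 'X^n) ^+ n = 1 + O('X^n)] does not change the
   derivatives of order [< n] at [0], but makes them all vanish at [1]. *)
Lemma steering_poly n (v : 'cV[R]_n) : exists p : {poly R},
  (forall i : 'I_n, (p^`(i)).[0] = v i 0) /\
  (forall i : 'I_n, (p^`(i)).[1] = 0).
Proof.
(* The Taylor polynomial at [0] with the prescribed derivatives; [insub] converts the exponent into
   an index of [v], and its default is never reached for [k < n]. *)
pose P := \poly_(k < n) (if insub k is Some i then v i 0 / (k`!)%:R else 0).
pose Q : {poly R} := (1 - 'X^n) ^+ n.
have [S QE] : exists S, Q = 1 + 'X^n * S.
  rewrite -[Q](subrK 1) -[X in Q - X](expr1n _ n) subrXX.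
  rewrite addrAC subrr add0r mulNr -mulrN addrC.
  by eexists.
(* Since [1] is a root of [1 - 'X^n], it is a root of multiplicity at least [n] of the power. *)
have [S' Q'E] : exists S', Q = ('X - 1%:P) ^+ n * S'.
  rewrite /Q -[X in X - _](expr1n _ n) subrXX -opprB mulNr -mulrN.
  by rewrite exprMn; eexists.
exists (P * Q); split => i.
  rewrite QE mulrDr mulr1 mulrCA linearD/= hornerD.
  have -> : 'X = 'X - (0 : R)%:P by rewrite subr0.
  rewrite derivn_mulXsub_root// addr0 horner_coef0 coef_derivn addn0 ffactnn.
  rewrite coef_poly ltn_ord valK -[LHS]mulr_natr divfK//.
by rewrite Q'E mulrCA derivn_mulXsub_root.
Qed.

Lemma derivn_comp_scaleX (c : R) (p : {poly R}) (i : nat) :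
  (p \Po (c *: 'X))^`(i) = c ^+ i *: (p^`(i) \Po (c *: 'X)).
Proof.
elim: i => [|i IH]; first by rewrite expr0 scale1r.
rewrite !derivnS IH derivZ deriv_comp derivZ derivX.
by rewrite -scalerAr mulr1 scalerA exprSr.
Qed.

Lemma poly_bounded01 (p : {poly R}) : exists C, 0 <= C /\
  forall s, 0 <= s <= 1 -> `|p.[s]| <= C.
Proof.
exists (\sum_(k < size p) `|p`_k|); split; first exact: sumr_ge0.
move=> s /andP[s0 s1]; rewrite horner_coef.
apply: (le_trans (ler_norm_sum _ _ _)); apply: ler_sum => k _.
rewrite normrM ler_piMr// normrX exprn_ile1// ?ger0_norm//.
Qed.

(** One steering polynomial [p] on [[0, 1]] is rescaled to $e^{n-1}p(s/e)$, whose derivative of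
    order $i$ carries the factor $e^{n-1-i}$. For $e\le1$ this is at most 1 for the states ($i<n$)
    and equals $1/e$ for the control ($i=n$), so [C] does not depend on [e]. The price is the
    weights on the initial state. *)
Lemma steering n (v : 'cV[R]_n) : (0 < n)%N -> exists C, 0 <= C /\
  forall e, 0 < e <= 1 -> exists (w : R -> R) (z : R -> 'cV[R]_n),
  [/\ trajectory (\col_i (e ^+ n.-1 / e ^+ i * v i 0)) w z,
      locally_integrable_control w,
      forall s, e <= s -> w s = 0 /\ z s = 0,
      forall s, 0 <= s -> `|w s| <= C / e &
      forall s i, 0 <= s -> `|z s i 0| <= C ].
Proof.
move=> n0; have [p [p0 p1]] := steering_poly v.
(* The [n] state coordinates and, at the extra index [n], the control. *)
have /choice[B BP] : forall i : 'I_n.+1, exists C, 0 <= C /\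
    forall s, 0 <= s <= 1 -> `|p^`(i).[s]| <= C.
  by move=> i; exact: poly_bounded01.
exists (\sum_i B i); split; first by apply: sumr_ge0 => i _; have [] := BP i.
have BC i s : (i <= n)%N -> 0 <= s <= 1 -> `|p^`(i).[s]| <= \sum_i B i.
  rewrite -ltnS => ltin s01; have [_ /(_ _ s01)] := BP (Ordinal ltin).
  move=> /le_trans; apply; rewrite (bigD1 (Ordinal ltin))//= lerDl.
  by apply: sumr_ge0 => k _; have [] := BP k.
have C0 : 0 <= \sum_i B i by apply: sumr_ge0 => i _; have [] := BP i.
move=> e /andP[e0 e1].
have eu : e != 0 by rewrite gt_eqF.
pose pe := e ^+ n.-1 *: (p \Po (e^-1 *: 'X)).
have peE i s : (pe^`(i)).[s] = e ^+ n.-1 / e ^+ i * (p^`(i)).[s / e].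
  rewrite derivnZ derivn_comp_scaleX scalerA hornerZ horner_comp !hornerE.
  by rewrite exprVn [e^-1 * s]mulrC.
exists (paste e (horner (pe^`(n))) (fun=> 0)).
exists (paste e (fun s => \col_(i < n) (pe^`(i)).[s]) (fun=> 0)).
have se s : 0 <= s -> s < e -> 0 <= s / e <= 1.
  by move=> s0 /ltW se; rewrite ler_pdivrMr// mul1r se divr_ge0// ltW.
split.
- have -> : \col_i (e ^+ n.-1 / e ^+ i * v i 0) = \col_(i < n) (pe^`(i)).[0].
    by apply/matrixP => i j; rewrite ord1 !mxE peE mul0r p0.
  apply: trajectory_paste; first exact: ltW.
  + exact: locally_integrable_control_poly.
  + exact: (locally_integrable_control_cst 0).
  + exact: trajectory_poly.
  + rewrite (_ : \col_i _ = 0); first exact: trajectory0.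
    by apply/matrixP => i j; rewrite ord1 !mxE peE divff// p1 mulr0.
- apply: locally_integrable_control_paste; first exact: ltW.
    exact: locally_integrable_control_poly.
  exact: (locally_integrable_control_cst 0).
- by move=> s es; rewrite !paste_ge.
- move=> s s0; have [lse|les] := ltP s e; last first.
    by rewrite paste_ge// normr0; apply: divr_ge0 => //; exact: ltW.
  rewrite paste_lt// peE normrM mulrC ler_pM//; first by rewrite BC// se.
  rewrite -{2}(prednK n0) exprS invfM mulrCA divff ?mulr1; last first.
    by rewrite expf_neq0.
  by rewrite ger0_norm// invr_ge0 ltW.
- move=> s i s0; have [lse|les] := ltP s e; last first.
    by rewrite paste_ge// mxE normr0.
  rewrite paste_lt// mxE peE normrM -[leRHS]mul1r ler_pM//; last first.
    by rewrite BC// ?se// ltnW.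
  have lein : (i <= n.-1)%N by rewrite -ltnS prednK.
  rewrite -{1}(subnK lein) exprD mulfK ?expf_neq0// normrX exprn_ile1//.
  by rewrite ger0_norm// ltW.
Qed.

End polynomials.

(** * Signed powers *)

Section powers.
Context {R : realType}.
Implicit Types a b u w : R.

Lemma norm_signed_power a r : 0 < r -> `|signed_power a r| = `|a| `^ r.
Proof.
move=> r0; rewrite normrM (ger0_norm (powR_ge0 _ _)) normr_sg.
by have [->|] := eqVneq a 0; rewrite ?mulr1// normr0 powR0 ?gt_eqF// mul0r.
Qed.

Lemma signed_powerN a r : signed_power (- a) r = - signed_power a r.
Proof. by rewrite /signed_power normrN sgrN mulrN. Qed.

Lemma signed_powerK a r : 0 < r -> signed_power (signed_power a r) r^-1 = a.
Proof.
move=> r0; rewrite {1}/signed_power norm_signed_power// -powRrM divff ?gt_eqF//.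
rewrite powRr1// sgrM sgr_id.
have [->|a0] := eqVneq a 0; first by rewrite normr0 mul0r.
rewrite [Num.sg (_ `^ _)]gtr0_sg ?mul1r; first by rewrite mulrC -numEsg.
by rewrite powR_gt0// normr_gt0.
Qed.

Lemma powR_le1D a s q : 0 <= s <= q -> `|a| `^ s <= 1 + `|a| `^ q.
Proof.
move=> /andP[s0 sq]; have [a1|a1] := leP `|a| 1.
  rewrite -[leLHS]addr0 lerD ?powR_ge0//.
  by rewrite (le_trans (ge0_ler_powR s0 _ _ a1)) ?nnegrE// powR1.
by rewrite ler_wpDl// ler_powR// ltW.
Qed.

Lemma measurable_signed_power r :
  measurable_fun [set: R] (fun a => signed_power a r).
Proof.
apply: measurable_funM.
  by apply: (measurableT_comp (@measurable_powR R r)); exact: normr_measurable.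
apply: nondecreasing_measurable => // x y xy.
have [x0|x0|x0] := ltgtP x 0; have [y0|y0|y0] := ltgtP y 0;
  try (exfalso; move: x0 y0 xy; lra).
- by rewrite !ltr0_sg.
- by rewrite (ltr0_sg x0) (gtr0_sg y0); lra.
- by rewrite (ltr0_sg x0) y0 sgr0; lra.
- by rewrite !gtr0_sg.
- by rewrite x0 (gtr0_sg y0) sgr0.
- by rewrite x0 y0.
Qed.

Lemma signed_power_unif_continuous r e : 0 < r -> 0 < e -> exists d, 0 < d /\
  forall a b, `|b| <= d ->
  `|signed_power (a + b) r - signed_power a r| <= e * (1 + `|a| `^ r).
Proof.
move=> r0 e0.
(* The threshold between the two regimes: [|a| <= p] and [|b| <= p] leave each signed power at most
   [e / 2] in size. *)
have [p [p0 pe]] : exists p, 0 < p /\ (2 * p) `^ r <= e / 2.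
  exists (((e / 2) `^ r^-1) / 2); split.
    by rewrite divr_gt0// powR_gt0// divr_gt0.
  by rewrite mulrC divfK// -powRrM mulVf ?gt_eqF// powRr1// divr_ge0// ltW.
have [d1 [d10 d11 d1e]] : exists d1, [/\ 0 < d1, d1 < 1 &
    forall c, `|c - 1| <= d1 -> `|c `^ r - 1| <= e].
  have pc : {for 1, continuous (fun c : R => c `^ r)}.
    apply/differentiable_continuous/derivable1_diffP/derivable_powR.
    by rewrite in_itv/= ltr01.
  have /cvgrPdist_le/(_ e e0) := pc.
  rewrite -nbhs_ballE => -[k /= k0 kP].
  exists (Num.min (k / 2) 2^-1); split.
  - by rewrite lt_min divr_gt0//= invr_gt0.
  - by rewrite gt_min invf_lt1 ?ltr1n ?orbT.
  - move=> c; rewrite le_min => /andP[ck _].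
    have {1}<- : (1 : R) `^ r = 1 by rewrite powR1.
    rewrite distrC; apply: kP.
    rewrite /ball/= distrC (le_lt_trans ck)//.
    by rewrite ltr_pdivrMr// ltr_pMr// ltr1n.
have e1 a : 0 <= e * `|a| `^ r by apply: mulr_ge0; [exact: ltW|exact: powR_ge0].
(* For [|a| > p], the bound [|b| <= p * d1] gives [|b / a| <= d1]; as [d1 < 1], the ratio [c] stays
   positive and the sign of [a] is kept. *)
exists (Num.min p (p * d1)); split; first by rewrite lt_min p0 mulr_gt0.
move=> a b; rewrite le_min => /andP[bp bd].
rewrite mulrDr mulr1.
have [ap|pa] := leP `|a| p.
  apply: (le_trans (ler_normB _ _)); rewrite !norm_signed_power//.
  apply: (@le_trans _ _ (e / 2 + e / 2)); last by rewrite -splitr lerDl.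
  have le2p x : `|x| <= 2 * p -> `|x| `^ r <= e / 2.
    move=> xp; apply: le_trans pe; apply: ge0_ler_powR => //; first exact: ltW.
      by rewrite nnegrE.
    by rewrite nnegrE mulr_ge0// ltW.
  apply: lerD; apply: le2p.
    by rewrite (le_trans (ler_normD _ _))// mulrDl mul1r lerD.
  by rewrite (le_trans ap)// mulrDl mul1r lerDl ltW.
have a0 : a != 0 by rewrite -normr_gt0 (lt_trans p0).
pose c := 1 + b / a.
have cd : `|c - 1| <= d1.
  rewrite /c addrAC subrr add0r normrM normfV ler_pdivrMr ?normr_gt0//.
  by rewrite (le_trans bd)// mulrC ler_wpM2l ?ltW.
have c0 : 0 < c.
  by move: cd; rewrite ler_norml => /andP[+ _]; move: d11; lra.
have -> : a + b = a * c by rewrite /c mulrDr mulr1 mulrCA divff// mulr1.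
rewrite /signed_power normrM [`|c|]gtr0_norm// sgrM (gtr0_sg c0) mulr1.
rewrite powRM//; last exact: ltW.
have -> : `|a| `^ r * c `^ r * Num.sg a - `|a| `^ r * Num.sg a =
    `|a| `^ r * (c `^ r - 1) * Num.sg a by ring.
rewrite !normrM normr_sg a0 mulr1 (ger0_norm (powR_ge0 _ _)) mulrC.
by rewrite (le_trans (ler_wpM2r (powR_ge0 _ _) (d1e _ cd)))// lerDr ltW.
Qed.

(* The tangent inequality of the convex function [|.|^q / q] at [a + b],
   which is Young's inequality for the exponents [q] and [q / (q - 1)]. *)
Lemma powR_tangent q a b : 1 < q ->
  `|a + b| `^ q / q - `|a| `^ q / q <= signed_power (a + b) (q - 1) * b.
Proof.
move=> q1; set y := a + b.
have q0 : 0 < q by rewrite (lt_trans _ q1).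
have r0 : 0 < q - 1 by rewrite subr_gt0.
have qu : q != 0 by rewrite gt_eqF.
have ru : q - 1 != 0 by rewrite gt_eqF.
have -> : b = y - a by rewrite /y addrC addKr.
have yy : signed_power y (q - 1) * y = `|y| `^ q.
  rewrite /signed_power -mulrA -normrEsg mulrC.
  by rewrite mulr_powRB1.
have ya : signed_power y (q - 1) * a <=
    `|a| `^ q / q + `|y| `^ q * ((q - 1) / q).
  apply: (le_trans (ler_norm _)); rewrite normrM norm_signed_power// mulrC.
  have := @conjugate_powR R `|a| (`|y| `^ (q - 1)) q (q / (q - 1)).
  rewrite -powRrM mulrCA divff// mulr1 invf_div; apply => //.
  - by rewrite divr_gt0.
  - by field.
rewrite mulrBr yy.
have -> : `|y| `^ q / q = `|y| `^ q - `|y| `^ q * ((q - 1) / q) by field.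
by move: ya; lra.
Qed.

(** The tangent at the midpoint is compared with both endpoints; the two linear terms are opposite
    and cancel in the sum. *)
Lemma powR_midpoint q a b : 1 < q ->
  `|(a + b) / 2| `^ q / q <= (`|a| `^ q / q + `|b| `^ q / q) / 2.
Proof.
move=> q1.
have Ha := @powR_tangent q a ((b - a) / 2) q1.
have Hb := @powR_tangent q b ((a - b) / 2) q1.
have Ea : a + (b - a) / 2 = (a + b) / 2 by field.
have Eb : b + (a - b) / 2 = (a + b) / 2 by field.
rewrite Ea in Ha; rewrite Eb in Hb.
have Ec : (a - b) / 2 = - ((b - a) / 2) by field.
rewrite Ec mulrN in Hb.
by move: Ha Hb; lra.
Qed.

(** The tangent at the perturbed point [u + w] bounds the increase from above; the hypothesis then
    exchanges its slope for the slope at [u]. *)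
Lemma powR_perturb q u w e d : 1 < q ->
  (forall b, `|b| <= d ->
     `|signed_power (u + b) (q - 1) - signed_power u (q - 1)| <=
     e * (1 + `|u| `^ (q - 1))) ->
  `|w| <= d ->
  `|u + w| `^ q / q <= `|u| `^ q / q + signed_power u (q - 1) * w +
    e * (1 + `|u| `^ (q - 1)) * `|w|.
Proof.
move=> q1 ud wd; have H := @powR_tangent q u w q1.
rewrite -lerBlDl opprD addrA.
have : (signed_power (u + w) (q - 1) - signed_power u (q - 1)) * w <=
       e * (1 + `|u| `^ (q - 1)) * `|w|.
  apply: (le_trans (ler_norm _)); rewrite normrM ler_wpM2r//; exact: ud.
rewrite mulrBl; move: H; lra.
Qed.

End powers.

(** * Controls and costs *)

Section controls.
Context {R : realType}.
Notation mu := (@lebesgue_measure R).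
Variable q : R.
Hypothesis q1 : 1 < q.

Let q0 : 0 < q. Proof. exact: lt_trans q1. Qed.

Lemma Lq_controlP (u : R -> R) : Lq_control q u <->
  measurable_fun (`[0, +oo[ : set R) u /\
  mu.-integrable (`[0, +oo[ : set R) (fun s => (`|u s| `^ q)%:E).
Proof.
have E : (fun s => (`|(u \_ `[0, +oo[) s| `^ q)%:E) =
         (fun s => (`|u s| `^ q)%:E) \_ `[0%R, +oo[.
  apply/funext => s; rewrite /patch; case: ifP => // _.
  by rewrite normr0 powR0// gt_eqF.
split.
  move=> /[dup] uL /Lfun_integrable/= /(_ (ltW q1)) ui; split.
    apply/(measurable_restrictT _ _).2 => //.
    by move: uL; rewrite /Lq_control inE => /andP[/[!inE]].
  by apply/integrable_mkcond => //; move: ui; rewrite E.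
move=> [mu_ ui]; rewrite /Lq_control inE; apply/andP; rewrite !inE/=; split.
  exact/(measurable_restrictT _ _).1.
rewrite /finite_norm unlock /Lnorm poweR_lty//.
have mD : measurable (`[0, +oo[ : set R) by [].
have := (integrable_mkcond (mu := mu) _ mD).1 ui.
rewrite -E => /integrableP[_].
by under eq_integral do rewrite gee0_abs ?lee_fin ?powR_ge0//.
Qed.

Lemma locally_integrable_control_measurable (u : R -> R) :
  locally_integrable_control u -> measurable_fun (`[0, +oo[ : set R) u.
Proof.
move=> ui.
have -> : `[0, +oo[%classic = \bigcup_k `[0, k%:R]%classic :> set R.
  apply/seteqP; split => [s /=|s [k _] /=].
    rewrite in_itv/= andbT => s0; exists (Num.truncn s).+1 => //=.
    by rewrite in_itv/= s0 ltW// truncnS_gt.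
  by rewrite !in_itv/= andbT => /andP[].
apply/measurable_fun_bigcup => // k.
by apply/measurable_EFinP; exact: (measurable_int _ (ui k%:R)).
Qed.

(** On a bounded interval constants are integrable, so [powR_le1D] dominates every lower power. The
    exponents of interest are [1] and [q - 1]. *)
Lemma integrable_finite_itv (u : R -> R) (s t : R) : 0 <= s <= q ->
  measurable_fun (`[0, +oo[ : set R) u ->
  mu.-integrable (`[0, +oo[ : set R) (fun s => (`|u s| `^ q)%:E) ->
  mu.-integrable `[0, t] (fun r => (`|u r| `^ s)%:E).
Proof.
move=> sq mu_ ui.
have sub : `[0, t] `<=` `[0, +oo[.
  by move=> r /=; rewrite !in_itv/= andbT => /andP[].
have i1 : mu.-integrable `[0, t] (fun r => (1 + `|u r| `^ q)%:E).
  apply: (@integrableD _ _ _ mu _ _ (cst 1%:E)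
    (fun r => (`|u r| `^ q)%:E)) => //.
    by exact: locally_integrable_control_cst.
  exact: integrableS ui.
apply: le_integrable i1 => //.
  apply/measurable_EFinP; apply: (measurableT_comp (@measurable_powR R s)).
  by apply: measurableT_comp => //; exact: measurable_funS mu_.
move=> r _ /=; rewrite lee_fin (ger0_norm (powR_ge0 _ _)).
by rewrite (le_trans _ (ler_norm _))// powR_le1D.
Qed.

Lemma Lq_control_locally_integrable (u : R -> R) :
  Lq_control q u -> locally_integrable_control u.
Proof.
move=> /Lq_controlP[mu_ ui] t.
have q01 : (0 : R) <= 1 <= q by rewrite ler01 ltW.
have i1 := integrable_finite_itv t q01 mu_ ui; apply: le_integrable i1 => //.
  apply/measurable_EFinP; apply: measurable_funS mu_ => // r /=.
  by rewrite !in_itv/= andbT => /andP[].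
by move=> r _ /=; rewrite powRr1// normr_id.
Qed.

Lemma locally_integrable_signed_power (u : R -> R) : Lq_control q u ->
  locally_integrable_control (fun s => signed_power (u s) (q - 1)).
Proof.
move=> /Lq_controlP[um uq] t.
have r0 : 0 < q - 1 by rewrite subr_gt0.
have rq : 0 <= q - 1 <= q by rewrite ltW//= gerBl ler01.
have := integrable_finite_itv t rq um uq.
apply: le_integrable => //.
  apply/measurable_EFinP.
  apply: (measurableT_comp (@measurable_signed_power R (q - 1))).
  apply: measurable_funS um => // s /=.
  by rewrite !in_itv/= andbT => /andP[].
move=> s _ /=; rewrite norm_signed_power// lee_fin.
by rewrite (ger0_norm (powR_ge0 _ _)).
Qed.

End controls.

Section cost.
Context {R : realType} (n : nat).
Notation mu := (@lebesgue_measure R).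
Variables (q : R) (F : 'cV[R]_n -> R).
Implicit Types (u v : R -> R) (x y : R -> 'cV[R]_n).
Hypothesis q1 : 1 < q.
Hypothesis F_cont : continuous F.
Hypothesis F_ge0 : forall a, 0 <= F a.

Let q0 : 0 < q. Proof. exact: lt_trans q1. Qed.

Definition running_cost (u : R -> R) (x : R -> 'cV[R]_n) (s : R) :=
  `|u s| `^ q / q + F (x s).

Lemma running_cost_ge0 u x s : 0 <= running_cost u x s.
Proof. by rewrite addr_ge0// divr_ge0 ?powR_ge0// ltW. Qed.

Lemma cost_ge0 u x : (0 <= cost q F u x)%E.
Proof. by apply: integral_ge0 => s _; rewrite lee_fin running_cost_ge0. Qed.

Lemma measurable_running_cost u x : locally_integrable_control u ->
  {within `[0, +oo[, continuous x} ->
  measurable_fun (`[0, +oo[ : set R) (running_cost u x).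
Proof.
move=> /locally_integrable_control_measurable um xc; apply: measurable_funD.
  apply: measurable_funM => //.
  apply: (measurableT_comp (@measurable_powR R q)).
  exact: measurableT_comp.
apply: subspace_continuous_measurable_fun => // s.
by apply: (cvg_comp _ F (xc s)); exact: F_cont.
Qed.

(** As [F] is nonnegative, [q] times the cost dominates the integral of $|u|^q$. *)
Lemma admissible_finite_cost (x0 : 'cV[R]_n) u x :
  locally_integrable_control u -> trajectory x0 u x ->
  (cost q F u x < +oo)%E -> admissible q x0 u x.
Proof.
move=> ui xT cfin; split => //; apply/(Lq_controlP q1).
have um := locally_integrable_control_measurable ui.
split => //; apply/integrableP; split.
  apply/measurable_EFinP; apply: (measurableT_comp (@measurable_powR R q)).
  exact: measurableT_comp.
have : (q%:E * cost q F u x < +oo)%E by rewrite lte_mul_pinfty// lee_fin ltW.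
rewrite /cost -ge0_integralZl//; first last.
- by rewrite lee_fin ltW.
- by move=> s _; rewrite lee_fin running_cost_ge0.
- by apply/measurable_EFinP; exact: (measurable_running_cost ui xT.1).
apply: le_lt_trans; apply: ge0_le_integral => //.
- apply/measurable_EFinP; apply: measurableT_comp => //.
  apply: (measurableT_comp (@measurable_powR R q)).
  exact: measurableT_comp.
- apply/measurable_EFinP; apply: measurable_funM => //.
  exact: (measurable_running_cost ui xT.1).
- move=> s _; rewrite -EFinM !lee_fin ger0_norm ?powR_ge0//.
  by rewrite mulrDr mulrCA divff ?gt_eqF// mulr1 lerDl mulr_ge0// ltW.
Qed.

Lemma cost_split u x t : 0 <= t -> locally_integrable_control u ->
  {within `[0, +oo[, continuous x} ->
  cost q F u x = (\int[mu]_(s in `[0%R, t[) (running_cost u x s)%:E +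
    cost q F (fun s => u (s + t)%R) (fun s => x (s + t)%R))%E.
Proof.
move=> t0 ui xc; have Lm := measurable_running_cost ui xc.
have -> : cost q F (fun s => u (s + t)%R) (fun s => x (s + t)%R) =
   (\int[mu]_(s in `[t, +oo[) (running_cost u x s)%:E)%E.
  rewrite (integral_shift t)//; last first.
    apply/measurable_EFinP; apply: measurable_funS Lm => // s /=.
    by rewrite !in_itv/= !andbT; exact: le_trans.
  by rewrite shift_preimage_itvy subrr.
have D : `[0, +oo[%classic = `[0, t[ `|` `[t, +oo[ :> set R.
  apply/seteqP; split => s /=; rewrite !in_itv/= !andbT.
    by move=> ->; have [|] := ltP s t; [left|right].
  by case=> [/andP[]//|]; exact: le_trans.
rewrite -ge0_integral_setU//.
- by rewrite -D.
- by apply/measurable_EFinP; rewrite -D.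
- by move=> s _; rewrite lee_fin running_cost_ge0.
- apply/disj_setPS => s /= [].
  by rewrite !in_itv/= => /andP[_ st] /andP[]; rewrite leNgt st.
Qed.

Lemma cost_ext u x v y : (forall s, 0 <= s -> u s = v s) ->
  (forall s, 0 <= s -> x s = y s) -> cost q F u x = cost q F v y.
Proof.
move=> uv xy; apply: eq_integral => s; rewrite inE/= in_itv/= andbT => s0.
by rewrite uv// xy.
Qed.

(** Optimality extends to locally integrable competitors: such a control either has infinite cost or
    is admissible. *)
Lemma optimal_le (x0 : 'cV[R]_n) u x v y : optimal q F x0 u x ->
  locally_integrable_control v -> trajectory x0 v y ->
  (cost q F u x <= cost q F v y)%E.
Proof.
move=> [_ opt] vi yT.
have := leey (cost q F v y); rewrite le_eqVlt => /predU1P[->|cfin].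
  exact: leey.
by apply: opt; exact: admissible_finite_cost cfin.
Qed.

(** A better tail pasted after time [t] would improve the whole pair. Finiteness of the cost allows
    the common integral over [[0, t[] to be cancelled in the extended reals. *)
Lemma tail_optimal (x0 : 'cV[R]_n) u x t : 0 <= t -> optimal q F x0 u x ->
  (cost q F u x < +oo)%E ->
  optimal q F (x t) (fun s => u (s + t)) (fun s => x (s + t)).
Proof.
move=> t0 opt cfin; have [[uL xT] _] := opt.
have ui := Lq_control_locally_integrable q1 uL.
have cS := cost_split t0 ui xT.1.
have I0 : (0 <= \int[mu]_(s in `[0%R, t[) (running_cost u x s)%:E)%E.
  by apply: integral_ge0 => s _; rewrite lee_fin running_cost_ge0.
have Ifin : (\int[mu]_(s in `[0%R, t[) (running_cost u x s)%:E)%E \is a fin_num.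
  rewrite ge0_fin_numE//; apply: le_lt_trans cfin.
  by rewrite cS leeDl// cost_ge0.
have uti := locally_integrable_control_shift t0 ui.
have xtT := trajectory_shift t0 ui xT.
split.
  apply: admissible_finite_cost => //; apply: le_lt_trans cfin.
  by rewrite cS leeDr.
move=> v y [/(Lq_control_locally_integrable q1) vi yT].
have pi := locally_integrable_control_paste t0 ui vi.
have pT := trajectory_paste t0 ui vi xT yT.
have := optimal_le opt pi pT.
rewrite cS (cost_split t0 pi pT.1).
have -> : (\int[mu]_(s in `[0%R, t[)
             (running_cost (paste t u v) (paste t x y) s)%:E =
           \int[mu]_(s in `[0%R, t[) (running_cost u x s)%:E)%E.
  apply: eq_integral => s; rewrite inE/= in_itv/= => /andP[_ st].
  by rewrite /running_cost !paste_lt.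
rewrite leeD2lE// => /le_trans; apply.
by rewrite (@cost_ext _ _ v y)// => s s0; rewrite paste_shift.
Qed.

(** The increment [g] has no sign, since it will contain a term linear in the perturbation. When the
    cost of [(u, x)] is finite, its running cost is integrable and [g], extended by zero, can be
    added to it; otherwise the bound is trivial. *)
Lemma cost_le_add u x v y (g : R -> R) e :
  locally_integrable_control u -> {within `[0, +oo[, continuous x} ->
  locally_integrable_control v -> {within `[0, +oo[, continuous y} ->
  mu.-integrable `[0, e] (EFin \o g) ->
  (forall s, 0 <= s <= e -> running_cost v y s <= running_cost u x s + g s) ->
  (forall s, e < s -> running_cost v y s <= running_cost u x s) ->
  (cost q F v y <= cost q F u x + (\int[mu]_(s in `[0, e]) g s)%:E)%E.
Proof.
move=> ui xc vi yc gi gle gle'.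
have := leey (cost q F u x); rewrite le_eqVlt => /predU1P[->|cfin].
  by rewrite addye// leey.
have Lm := measurable_running_cost ui xc.
have sub : `[0, e]%classic `<=` `[0, +oo[.
  by move=> s /=; rewrite !in_itv/= => /andP[->].
have Li : mu.-integrable (`[0, +oo[ : set R) (EFin \o running_cost u x).
  apply/integrableP; split; first exact/measurable_EFinP.
  apply: le_lt_trans cfin.
  by under eq_integral do rewrite gee0_abs ?lee_fin ?running_cost_ge0//.
have Gi : mu.-integrable (`[0, +oo[ : set R) ((EFin \o g) \_ `[0, e]).
  by apply/integrable_restrict => //; rewrite setIidr.
have -> : (\int[mu]_(s in `[0, e]) g s)%:E =
    (\int[mu]_(s in `[0%R, +oo[) ((EFin \o g) \_ `[0%R, e]) s)%E.
  rewrite -integral_mkcondr setIidr// /Rintegral fineK//.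
  exact: integrable_fin_num.
rewrite /cost -integralD//.
apply: ge0_le_integral => //.
- by move=> s _; rewrite lee_fin running_cost_ge0.
- by apply/measurable_EFinP; exact: (measurable_running_cost vi yc).
- apply: emeasurable_funD; first exact/measurable_EFinP.
  exact: (measurable_int _ Gi).
- move=> s /=; rewrite in_itv/= andbT => s0; rewrite /patch.
  case: ifPn => [|/negP]; rewrite ?inE/= in_itv/= s0/=.
    by move=> se; rewrite -EFinD lee_fin gle// s0.
  by move=> /negP; rewrite -ltNge adde0 lee_fin => /gle'.
Qed.

End cost.

(** * Perturbation of an optimal pair *)

Section bounds.
Context {R : realType} (n : nat).
Variable F : 'cV[R]_n -> R.

Lemma continuous_bounded_box (M : R) : continuous F -> 0 <= M ->
  exists K, forall v : 'cV[R]_n, (forall i, `|v i 0| <= M) -> F v <= K.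
Proof.
move=> Fc M0.
(* The box is formed in row vectors, where it is compact as a product of segments, and carried to
   columns by a continuous map. *)
pose A := [set r : 'rV[R]_n | forall i, `[- M, M]%classic (r ord0 i)].
have Ac : compact A.
  apply: (@rV_compact R n (fun=> `[- M, M]%classic)) => i.
  exact: segment_compact.
have A0 : A !=set0.
  by exists 0 => i /=; rewrite mxE in_itv/= oppr_le0 M0.
have Tc : continuous (fun r : 'rV[R]_n => \col_i r 0 i : 'cV[R]_n).
  by apply: continuous_col => i; exact: coord_continuous.
have [|r _ rmax] := @EVT_max_rV R n (fun r => F (\col_i r 0 i)) A A0 Ac.
  apply: continuous_subspaceT => r.
  by apply: (cvg_comp _ F (Tc r)); exact: Fc.
exists (F (\col_i r 0 i)) => v vM.
have -> : v = \col_i (\row_j v j 0) 0 i.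
  by apply/matrixP => i j; rewrite ord1 !mxE.
by apply: rmax; rewrite inE => i /=; rewrite mxE in_itv/= -ler_norml.
Qed.

Lemma within_continuous_bounded (x : R -> 'cV[R]_n) (t : R) : 0 <= t ->
  {within `[0, +oo[, continuous x} ->
  exists M, 0 <= M /\ forall s i, 0 <= s <= t -> `|x s i 0| <= M.
Proof.
move=> t0 xc.
have /choice[B BP] : forall i : 'I_n, exists M,
    forall s, 0 <= s <= t -> `|x s i 0| <= M.
  move=> i; have [|c _ cmax] := @EVT_max R (fun s => `|x s i 0|) 0 t t0.
    move=> s; have : {within `[0, t], continuous (fun s => x s i 0)}.
      apply: coord_within_continuous; apply: continuous_subspaceW xc => r /=.
      by rewrite !in_itv/= => /andP[->].
    by move=> /(_ s); exact: cvg_norm.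
  by exists `|x c i 0| => s st; apply: cmax; rewrite in_itv.
have B0 i : 0 <= B i by rewrite (le_trans _ (BP i 0 _)) ?lexx.
exists (\sum_i B i); split; first exact: sumr_ge0.
move=> s i st; apply: (le_trans (BP i s st)).
by rewrite (bigD1 i)//= lerDl sumr_ge0.
Qed.

Lemma convex_functionP : convex_function [set: convex_lmodType 'cV[R]_n] F ->
  forall a b t, 0 <= t <= 1 ->
  F (t *: a + (1 - t) *: b) <= t * F a + (1 - t) * F b.
Proof.
move=> Fx a b t /andP[t0 t1].
by have /(_ a b) := Fx (Itv01 t0 t1); rewrite !inE => /(_ I I).
Qed.

(** The point [a + h *: z] lies at parameter [|h|] on the segment from [a] to [a + z] or [a - z],
    according to the sign of [h]. Nonnegativity of [F a] lets the term [- |h| * F a] be dropped. *)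
Lemma convex_perturb (K h : R) a z :
  convex_function [set: convex_lmodType 'cV[R]_n] F ->
  (forall b, 0 <= F b) -> `|h| <= 1 ->
  F (a + z) <= K -> F (a - z) <= K -> F (a + h *: z) <= F a + `|h| * K.
Proof.
move=> Fx F0 h1 Kp Km.
have h01 : 0 <= `|h| <= 1 by rewrite normr_ge0.
have key b : F b <= K -> F (`|h| *: b + (1 - `|h|) *: a) <= F a + `|h| * K.
  move=> bK; apply: (le_trans (convex_functionP Fx b a h01)).
  rewrite mulrBl mul1r addrC -addrA lerD2l.
  have := ler_wpM2l (normr_ge0 h) bK; have := mulr_ge0 (normr_ge0 h) (F0 a).
  lra.
have [h0|h0] := leP 0 h.
  have := key _ Kp; rewrite ger0_norm//; congr (F _ <= _).
  by apply/matrixP => i j; rewrite !mxE; ring.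
have := key _ Km; rewrite ltr0_norm//; congr (F _ <= _).
by apply/matrixP => i j; rewrite !mxE; ring.
Qed.

End bounds.

Section perturbation.
Context {R : realType} (n : nat).
Notation mu := (@lebesgue_measure R).
Variables (q : R) (F : 'cV[R]_n -> R).
Hypothesis n0 : (0 < n)%N.
Hypothesis q1 : 1 < q.
Hypothesis F_cont : continuous F.
Hypothesis F_ge0 : forall a, 0 <= F a.
Hypothesis F0 : F 0 = 0.
Hypothesis F_convex : convex_function [set: convex_lmodType 'cV[R]_n] F.

Let q0 : 0 < q. Proof. exact: lt_trans q1. Qed.

Lemma running_cost0 u (x : R -> 'cV[R]_n) s : u s = 0 -> x s = 0 ->
  running_cost q F u x s = 0.
Proof.
move=> us xs; rewrite /running_cost us xs F0 normr0 powR0 ?gt_eqF//.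
by rewrite mul0r addr0.
Qed.

(** Steering in time [e = 1] makes all the weights on the initial state equal to 1, so any [x0] can
    be brought to rest at the origin, where no further cost accrues. *)
Lemma finite_cost_exists (x0 : 'cV[R]_n) : exists u x,
  admissible q x0 u x /\ (cost q F u x < +oo)%E.
Proof.
have [C [C0 CP]] := steering x0 n0.
have [|w [z [zT wi wz0 wC zC]]] := CP 1; first by rewrite ltr01 lexx.
have [K KP] := continuous_bounded_box F_cont C0.
have zT' : trajectory x0 w z.
  move: zT; congr (trajectory _ w z); apply/matrixP => i j.
  by rewrite ord1 mxE !expr1n divr1 mul1r.
have fin : (cost q F w z < +oo)%E.
  have ci : mu.-integrable `[0, 1] (EFin \o (fun=> C `^ q / q + K)).
    exact: locally_integrable_control_cst.
  (* Comparison with the zero pair, of cost 0; the increment is a constant bound on [[0, 1]]. *)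
  have := @cost_le_add R n q F q1 F_cont F_ge0 (fun=> 0) (fun=> 0) w z
    (fun=> C `^ q / q + K) 1 (locally_integrable_control_cst 0)
    (trajectory0 n).1 wi zT.1 ci.
  have -> : cost q F (fun=> 0) (fun=> 0) = 0%E.
    apply: integral0_eq => s _.
    by rewrite -/(running_cost q F _ _ s) running_cost0.
  rewrite add0e => H; apply: le_lt_trans (H _ _) (ltry _).
    move=> s /andP[s0 _]; rewrite [X in _ <= X + _]running_cost0// add0r.
    apply: lerD.
      rewrite ler_pM2r ?invr_gt0//; apply: ge0_ler_powR; rewrite ?nnegrE//.
        exact: ltW.
      by have := wC s s0; rewrite divr1.
    by apply: KP => i; exact: zC.
  by move=> s /ltW s1; have [ws zs] := wz0 s s1; rewrite !running_cost0.
by exists w, z; split => //; exact: admissible_finite_cost.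
Qed.

(** The only nonzero entry of [last_basis] is the last one, where the weight of [steering] is 1. The
    integral is -1 because the last state coordinate is a primitive of [w] and goes from 1 to 0. *)
Lemma impulse : exists C, 0 <= C /\
  forall e, 0 < e <= 1 -> exists (w : R -> R) (z : R -> 'cV[R]_n),
  [/\ trajectory (last_basis R n) w z /\ locally_integrable_control w,
      \int[mu]_(s in `[0, e]) w s = -1,
      forall s, e <= s -> w s = 0 /\ z s = 0,
      forall s, 0 <= s -> `|w s| <= C / e &
      forall s i, 0 <= s -> `|z s i 0| <= C ].
Proof.
have [C [C0 CP]] := steering (last_basis R n) n0.
exists C; split => // e e01; have [w [z [zT wi wz0 wC zC]]] := CP e e01.
have /andP[e0 _] := e01.
have {}zT : trajectory (last_basis R n) w z.
  move: zT; congr (trajectory _ w z); apply/matrixP => i j; rewrite ord1 !mxE.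
  case: eqP => [iN|]; last by rewrite mulr0.
  have -> : n.-1 = i by rewrite -[LHS]/(n.-1) -{1}iN.
  by rewrite divff ?mul1r// expf_neq0// gt_eqF.
exists w, z; split => //.
have [i iN] : exists i : 'I_n, i.+1 = n.
  have lt : (n.-1 < n)%N by rewrite prednK.
  by exists (Ordinal lt); rewrite /= prednK.
have [_ ze] := wz0 e (lexx e).
have := zT.2 e (ltW e0) i; rewrite ze !mxE iN eqxx.
under eq_Rintegral do rewrite -/(rhs _ _) (rhs_last _ _ iN).
by move/eqP; rewrite eq_sym addrC addr_eq0 => /eqP.
Qed.

(* The hypothesis on [U] holds for [U = u 0] when [0] is a Lebesgue point of the
   signed power of [u]. *)
Lemma perturbed_cost (y : 'cV[R]_n) u x (U : R) :
  admissible q y u x ->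
  (forall eta, 0 < eta -> exists e, [/\ 0 < e, e <= 1, e <= eta &
    \int[mu]_(s in `[0, e])
      `|signed_power (u s) (q - 1) - signed_power U (q - 1)| <= eta * e]) ->
  forall eta, 0 < eta -> exists d, 0 < d /\ forall h, `|h| < d ->
  exists v x', [/\ locally_integrable_control v,
    trajectory (y + h *: last_basis R n) v x' &
    (cost q F v x' <= cost q F u x +
       (- h * signed_power U (q - 1) + eta * `|h|)%:E)%E].
Proof.
move=> [uL xT] uU eta eta0.
have ui := Lq_control_locally_integrable q1 uL.
have [um uq] := (Lq_controlP q1 u).1 uL.
set r := q - 1; have r0 : 0 < r by rewrite subr_gt0.
have [C [C0 CP]] := impulse.
have [M [M0 xM]] := within_continuous_bounded ler01 xT.1.
have [K0 K0P] := continuous_bounded_box F_cont (addr_ge0 M0 C0).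
pose K := Num.max 0 K0.
have Kge0 : 0 <= K by rewrite le_max lexx.
pose S := `|U| `^ r; have S0 : 0 <= S := powR_ge0 _ _.
(* [B] collects the coefficients of [a] in the final error, where [C * (1 + a)] is at most [C + C];
   the [1] keeps it positive. *)
pose B := C + C * (1 + S) + C + K + 1.
have B1 : 1 <= B by rewrite /B; have := mulr_ge0 C0 S0; lra.
pose a := Num.min 1 (eta / B).
have a0 : 0 < a by rewrite lt_min ltr01 divr_gt0// (lt_le_trans ltr01).
have a1 : a <= 1 by rewrite ge_min lexx.
have aB : a * B <= eta.
  by rewrite -ler_pdivlMr ?(lt_le_trans ltr01)// ge_min lexx orbT.
have [e [e0 e1 ea eI]] := uU a a0.
have [d1 [d10 d1P]] := signed_power_unif_continuous r0 a0.
have [|w [z [[zT wi] wI wz0 wC zC]]] := CP e; first by rewrite e0.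
have Ce0 : 0 <= C / e by rewrite divr_ge0// ltW.
(* With [e] now fixed, this forces [|h * w s| <= d1]; the [+ 1] avoids dividing by zero when
   [C = 0]. *)
exists (Num.min 1 (d1 / (C / e + 1))); split.
  by rewrite lt_min ltr01 divr_gt0// ltr_wpDl.
move=> h; rewrite lt_min => /andP[/ltW h1 hd].
have hC : `|h| * (C / e) <= d1.
  move: hd; rewrite ltr_pdivlMr ?ltr_wpDl// mulrDr mulr1 => /ltW.
  by apply: le_trans; rewrite lerDl.
pose E (s : R) : R := `|signed_power (u s) r - signed_power U r|.
have Ei : mu.-integrable `[0, e] (EFin \o E).
  apply: (@integrable_norm _ _ _ mu _
    (fun s => signed_power (u s) r - signed_power U r)) => //.
  apply: (@integrableB _ _ _ mu _ _ (fun s => (signed_power (u s) r)%:E)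
    (fun=> (signed_power U r)%:E)) => //.
    exact: (locally_integrable_signed_power q1 uL).
  exact: locally_integrable_control_cst.
pose A := C / e * (1 + a); pose D := C / e * a * (1 + S) + K.
have A0 : 0 <= A by rewrite mulr_ge0// addr_ge0// ltW.
(* [G s] bounds the increase of the running cost at time [s]. *)
pose G (s : R) : R := (h * signed_power U r) * w s + `|h| * (A * E s + D).
have cDi : mu.-integrable `[0, e] (EFin \o (fun=> D)).
  exact: locally_integrable_control_cst.
have AEi : mu.-integrable `[0, e] (EFin \o (fun s => A * E s)).
  exact: (integrableZl _ A Ei).
have Gi2 : mu.-integrable `[0, e] (EFin \o (fun s => A * E s + D)).
  exact: (integrableD _ AEi cDi).
have Gi1 : mu.-integrable `[0, e]
    (EFin \o (fun s => (h * signed_power U r) * w s)).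
  exact: (integrableZl _ _ (wi e)).
have Gi3 : mu.-integrable `[0, e] (EFin \o (fun s => `|h| * (A * E s + D))).
  exact: (integrableZl _ _ Gi2).
have Gi : mu.-integrable `[0, e] (EFin \o G) by exact: (integrableD _ Gi1 Gi3).
have GE : \int[mu]_(s in `[0, e]) G s <= - h * signed_power U r + eta * `|h|.
  rewrite RintegralD// !RintegralZl// RintegralD// RintegralZl//.
  rewrite Rintegral_cst// wI mulrN1 mulNr lerD2l mulrC ler_wpM2r//.
  have mue : fine (mu (`[0, e]%classic : set R)) = e.
    by rewrite lebesgue_measure_itv/= lte_fin e0 /= subr0.
  rewrite mue.
  apply: le_trans aB.
  have AE : A * \int[mu]_(s in `[0, e]) E s <= C * (1 + a) * a.
    apply: (le_trans (ler_wpM2l A0 eI)); rewrite /A.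
    by rewrite le_eqVlt; apply/orP; left; apply/eqP; field; rewrite gt_eqF.
  (* The state cost becomes small here through [e <= a]. *)
  have DE : D * e <= C * a * (1 + S) + K * a.
    rewrite mulrDl lerD ?ler_wpM2l//.
    by rewrite le_eqVlt; apply/orP; left; apply/eqP; field; rewrite gt_eqF.
  apply: (le_trans (lerD AE DE)).
  have : C * a * a <= C * a by rewrite ler_piMr// mulr_ge0// ltW.
  rewrite /B; nra.
have ptT := trajectory_linear 1 h ui wi xT zT.
exists (fun s => 1 * u s + h * w s), (fun s => 1 *: x s + h *: z s).
have pui : locally_integrable_control (fun s => 1 * u s + h * w s).
  exact: locally_integrable_control_linear.
split => //; first by move: ptT; rewrite scale1r.
have := @cost_le_add R n q F q1 F_cont F_ge0 u x _ _ G e ui xT.1 pui ptT.1 Gi.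
move=> H; apply: le_trans (H _ _) _; last 1 first.
- by rewrite leeD2l// lee_fin.
- move=> s /andP[s0 se]; rewrite /running_cost scale1r mul1r.
  have s01 : 0 <= s <= 1 by rewrite s0 (le_trans se).
  have ws := wC s s0.
  have hw : `|h * w s| <= `|h| * (C / e) by rewrite normrM ler_wpM2l.
  have P1 := @powR_perturb R q (u s) (h * w s) a d1 q1 (d1P (u s))
    (le_trans hw hC).
  have xz (z' : 'cV[R]_n) : (forall i, `|z' i 0| <= C) -> F (x s + z') <= K.
    move=> z'C; rewrite le_max K0P ?orbT// => i.
    by rewrite mxE (le_trans (ler_normD _ _))// lerD// xM.
  have P2 : F (x s + h *: z s) <= F (x s) + `|h| * K.
    apply: convex_perturb => //; apply: xz => i; first exact: zC.
    by rewrite mxE normrN zC.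
  have P3 : signed_power (u s) r * (h * w s) <=
      h * signed_power U r * w s + `|h| * (C / e * E s).
    have : (signed_power (u s) r - signed_power U r) * (h * w s) <=
           E s * (`|h| * (C / e)).
      apply: (le_trans (ler_norm _)); rewrite normrM ler_wpM2l//.
    by rewrite mulrBl; lra.
  have P4 : a * (1 + `|u s| `^ r) * `|h * w s| <=
      `|h| * (C / e * a * (1 + S + E s)).
    have uS : `|u s| `^ r <= S + E s.
      rewrite -!norm_signed_power// /S -norm_signed_power// -lerBlDl.
      exact: (le_trans (ler_norm _) (ler_dist_dist _ _)).
    have -> : `|h| * (C / e * a * (1 + S + E s)) =
              (a * (1 + S + E s)) * (`|h| * (C / e)) by ring.
    apply: ler_pM => //.
      by rewrite mulr_ge0 ?addr_ge0 ?powR_ge0// ltW.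
    by apply: ler_wpM2l; [exact: ltW|rewrite -addrA lerD2l].
  rewrite /G /A /D; move: P1 P2 P3 P4; rewrite -/r; lra.
- by move=> s /ltW es; have [ws zs] := wz0 s es; rewrite /running_cost ws zs
    mulr0 scaler0 !addr0 mul1r scale1r.
Qed.

End perturbation.

(** * Directional derivative of the value function *)

Section value.
Context {R : realType} (n : nat).
Notation mu := (@lebesgue_measure R).
Variables (q : R) (F : 'cV[R]_n -> R).
Implicit Types (u v : R -> R) (x y z : R -> 'cV[R]_n).
Hypothesis n0 : (0 < n)%N.
Hypothesis q1 : 1 < q.
Hypothesis F_cont : continuous F.
Hypothesis F_ge0 : forall a, 0 <= F a.
Hypothesis F0 : F 0 = 0.
Hypothesis F_convex : convex_function [set: convex_lmodType 'cV[R]_n] F.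

Let q0 : 0 < q. Proof. exact: lt_trans q1. Qed.

(** The dynamics is linear, so the average of two pairs is again a trajectory, and the running cost
    is the sum of a convex function of the control and one of the state. *)
Lemma midpoint_cost (a b : 'cV[R]_n) u x v y :
  admissible q a u x -> admissible q b v y -> exists w z,
  [/\ locally_integrable_control w, trajectory (2^-1 *: a + 2^-1 *: b) w z &
      (cost q F w z <= 2^-1%:E * cost q F u x + 2^-1%:E * cost q F v y)%E].
Proof.
move=> [/(Lq_control_locally_integrable q1) ui xT].
move=> [/(Lq_control_locally_integrable q1) vi yT].
have h0 : 0 <= 2^-1 :> R by rewrite invr_ge0.
have wT := trajectory_linear 2^-1 2^-1 ui vi xT yT.
have wi : locally_integrable_control (fun s => 2^-1 * u s + 2^-1 * v s).
  exact: locally_integrable_control_linear.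
have Lu := measurable_running_cost q F_cont ui xT.1.
have Lv := measurable_running_cost q F_cont vi yT.1.
set w := (fun s => 2^-1 * u s + _) in wT wi *.
set z := (fun s => 2^-1 *: x s + _) in wT *.
exists w, z; split => //.
rewrite /cost -!ge0_integralZl//; first last.
- by move=> s _; rewrite lee_fin; exact: (running_cost_ge0 q1 F_ge0).
- exact/measurable_EFinP.
- by move=> s _; rewrite lee_fin; exact: (running_cost_ge0 q1 F_ge0).
- exact/measurable_EFinP.
rewrite -ge0_integralD//; first last.
- by apply/measurable_EFinP; exact: measurable_funM.
- move=> s _; rewrite -EFinM lee_fin mulr_ge0//.
  exact: (running_cost_ge0 q1 F_ge0).
- by apply/measurable_EFinP; exact: measurable_funM.
- move=> s _; rewrite -EFinM lee_fin mulr_ge0//.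
  exact: (running_cost_ge0 q1 F_ge0).
apply: ge0_le_integral => //.
- by move=> s _; rewrite lee_fin; exact: (running_cost_ge0 q1 F_ge0 w z).
- by apply/measurable_EFinP; exact: (measurable_running_cost q F_cont wi wT.1).
- by apply: emeasurable_funD; apply: measurable_funeM; exact/measurable_EFinP.
move=> s _; rewrite -!EFinM -EFinD lee_fin /w /z.
have -> : 2^-1 * u s + 2^-1 * v s = (u s + v s) / 2 by field.
have h01 : 0 <= (2^-1 : R) <= 1 by rewrite h0 invf_le1 ?ler1n.
have := convex_functionP F_convex (x s) (y s) h01.
have -> : 1 - 2^-1 = 2^-1 :> R by field.
have := @powR_midpoint R q (u s) (v s) q1.
lra.
Qed.

(** The infimum before [fine] is applied; its finiteness ensures that the real value function is the
    true infimum and not a default. *)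
Definition ereal_value (a : 'cV[R]_n) : \bar R :=
  ereal_inf [set c | exists u x, admissible q a u x /\ c = cost q F u x].

Lemma ereal_valueE a : ereal_value a = (value_function q F a)%:E.
Proof.
have [u [x [ux fin]]] := finite_cost_exists n0 q1 F_cont F_ge0 F0 a.
rewrite /value_function fineK// -/(ereal_value a).
rewrite ge0_fin_numE.
  apply: le_lt_trans fin; apply: ereal_inf_lbound.
  by exists u, x.
apply: le_ereal_inf_tmp => _ [v [y [_ ->]]]; exact: cost_ge0.
Qed.

Lemma value_le a v z : locally_integrable_control v -> trajectory a v z ->
  ((value_function q F a)%:E <= cost q F v z)%E.
Proof.
move=> vi zT.
have := leey (cost q F v z); rewrite le_eqVlt => /predU1P[->|fin].
  exact: leey.
rewrite -ereal_valueE; apply: ereal_inf_lbound; exists v, z; split => //.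
exact: admissible_finite_cost fin.
Qed.

Lemma value_optimal a u x : optimal q F a u x ->
  cost q F u x = (value_function q F a)%:E.
Proof.
move=> [ux opt]; apply/eqP; rewrite eq_le; apply/andP; split; last first.
  apply: value_le; last exact: ux.2.
  exact: Lq_control_locally_integrable ux.1.
rewrite -ereal_valueE; apply: le_ereal_inf_tmp => _ [v [y [vy ->]]].
exact: opt.
Qed.

Lemma value_adherent a e : 0 < e -> exists u x, admissible q a u x /\
  (cost q F u x <= (value_function q F a + e)%:E)%E.
Proof.
move=> e0.
have : ereal_value a \is a fin_num by rewrite ereal_valueE.
move=> /(lb_ereal_inf_adherent e0)[_ [u [x [ux ->]]]].
rewrite -/(ereal_value a) ereal_valueE => /ltW ce.
by exists u, x.
Qed.

(** Averages of near-minimizers compete at the midpoint, with a slack [e] that is arbitrary. *)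
Lemma value_midpoint a b :
  value_function q F (2^-1 *: a + 2^-1 *: b) <=
  2^-1 * value_function q F a + 2^-1 * value_function q F b.
Proof.
apply/ler_addgt0Pr => e e0.
have [u [x [ux cu]]] := value_adherent a e0.
have [v [y [vy cv]]] := value_adherent b e0.
have [w [z [wi zT cw]]] := midpoint_cost ux vy.
rewrite -lee_fin; apply: (le_trans (value_le wi zT)); apply: (le_trans cw).
have h0 : (0 <= 2^-1%:E :> \bar R)%E by rewrite lee_fin invr_ge0.
apply: (le_trans (leeD (lee_wpmul2l h0 cu) (lee_wpmul2l h0 cv))).
by rewrite -!EFinM -EFinD lee_fin; lra.
Qed.

Lemma derive_value a u x (U : R) : optimal q F a u x ->
  (forall eta, 0 < eta -> exists e, [/\ 0 < e, e <= 1, e <= eta &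
    \int[mu]_(s in `[0, e])
      `|signed_power (u s) (q - 1) - signed_power U (q - 1)| <= eta * e]) ->
  'D_(last_basis R n) (value_function q F) a = - signed_power U (q - 1).
Proof.
move=> opt uU; set V := value_function q F; set en := last_basis R n.
set P := signed_power U (q - 1).
have up eta : 0 < eta -> exists d, 0 < d /\ forall h, `|h| < d ->
    V (a + h *: en) <= V a - h * P + eta * `|h|.
  move=> eta0.
  have [d [d0 dP]] := perturbed_cost n0 q1 F_cont F_ge0 F_convex opt.1 uU eta0.
  exists d; split => // h /dP[v [z [vi zT]]].
  rewrite (value_optimal opt) => cv.
  rewrite -lee_fin; apply: (le_trans (value_le vi zT)); apply: (le_trans cv).
  by rewrite -EFinD lee_fin mulNr addrA.
have main eta : 0 < eta -> exists d, 0 < d /\ forall h, `|h| < d ->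
    `|V (a + h *: en) - V a + h * P| <= eta * `|h|.
  move=> /up[d [d0 dP]]; exists d; split => // h hd.
  have h1 := dP h hd; have := dP (- h); rewrite normrN => /(_ hd) h2.
  (* Here $2V(a)\le V(a+he_n)+V(a-he_n)$, so the upper bound at [- h] turns into the matching lower
     bound at [h]. *)
  have := value_midpoint (a + h *: en) (a + (- h) *: en).
  rewrite -/V (_ : 2^-1 *: _ + 2^-1 *: _ = a) => [h3|]; last first.
    by apply/matrixP => i j; rewrite !mxE; field.
  by rewrite ler_norml; apply/andP; split; lra.
(* The difference quotient is shown to converge, so the value found is a genuine derivative and not
   the default of [lim]. *)
rewrite /derive; apply: cvg_lim => //.
apply/cvgrPdist_le => eta eta0.
have [d [d0 dP]] := main eta eta0.
exists d => //= h /=; rewrite sub0r normrN => hd hn0.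
rewrite [h *: _ + a]addrC distrC.
have -> : h^-1 *: (V (a + h *: en) - V a : R^o) - - P =
    h^-1 * (V (a + h *: en) - V a + h * P).
  by rewrite /GRing.scale/=; field.
rewrite normrM normfV ler_pdivrMl ?normr_gt0// [leRHS]mulrC.
exact: dP.
Qed.

End value.

(** * Lebesgue points *)

Section lebesgue_points.
Context {R : realType}.
Notation mu := (@lebesgue_measure R).

(** Extension by zero to the whole line, where Lebesgue differentiation is applied. *)
Lemma locally_integrable_patch (f : R -> R) :
  locally_integrable_control f -> locally_integrable setT (f \_ `[0, +oo[).
Proof.
move=> fi; split.
- apply/(measurable_restrictT _ _).1 => //.
  exact: locally_integrable_control_measurable.
- exact: openT.
- move=> K _ Kc.
  have mK : measurable K by exact: compact_measurable.
  have [M [_ MP]] := compact_bounded Kc.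
  have KM : K `&` `[0, +oo[ `<=` `[0, M + 1].
    move=> s /= [Ks]; rewrite !in_itv/= andbT => s0; rewrite s0/=.
    by rewrite (le_trans (ler_norm _))// (MP (M + 1))// ltrDl.
  have : mu.-integrable K ((EFin \o f) \_ `[0, +oo[).
    apply/integrable_restrict => //.
    by apply: integrableS (fi (M + 1)) => //; exact: measurableI.
  by rewrite restrict_EFin => /integrableP[].
Qed.

(** The interval [[t, t + e[] is the right half of the ball of radius [e], whose measure [2 * e]
    produces the factor 2. The closed endpoint is removed because the ball is open. *)
Lemma Rintegral_le_davg (g : R -> R) (t e c : R) : 0 < e ->
  measurable_fun setT g -> (davg g t e <= c%:E)%E ->
  \int[mu]_(s in `[0, e]) `|g (s + t) - g t| <= c * (2 * e).
Proof.
move=> e0 mg dc.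
have e20 : 0 < 2 * e by rewrite mulr_gt0.
have mh (D : set R) : measurable D ->
    measurable_fun D (fun s => `|(g s - g t)%:E|%E).
  move=> mD; do 2 apply: measurableT_comp => //.
  by apply: measurable_funB => //; exact: measurable_funTS.
have mb : mu (ball t e) = (2 * e)%:E.
  by rewrite lebesgue_measure_ball ?ltW// mulr_natl.
have Ic : (\int[mu]_(s in ball t e) `|(g s - g t)%:E| <= (c * (2 * e))%:E)%E.
  move: dc; rewrite /davg /iavg mb inver gt_eqF// lee_pdivrMl//.
  by rewrite -EFinM [in leRHS]mulrC.
have Je : (\int[mu]_(s in `[0%R, e]) `|g (s + t)%R - g t|%:E =
          \int[mu]_(s in `[t, (t + e)%R[) `|(g s - g t)%:E|)%E.
  rewrite integral_itv_bndo_bndc; last exact: mh.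
  rewrite [RHS](integral_shift t)//; last exact: mh.
  by rewrite shift_preimage_itv subrr addrAC subrr add0r.
have Jc : (\int[mu]_(s in `[0%R, e]) `|g (s + t)%R - g t|%:E <=
           (c * (2 * e))%:E)%E.
  apply: le_trans Ic; rewrite Je; apply: ge0_subset_integral => //.
  - exact: measurable_ball.
  - by apply: mh; exact: measurable_ball.
  - move=> s /=; rewrite in_itv/= => /andP[ts ste].
    by rewrite /ball/= ler0_norm ?subr_le0// opprB ltrBlDl.
rewrite -lee_fin /Rintegral fineK// ge0_fin_numE; last exact: integral_ge0.
exact: le_lt_trans Jc (ltry _).
Qed.

Lemma lebesgue_pt_right (f : R -> R) (t : R) : 0 <= t ->
  locally_integrable_control f -> lebesgue_pt (f \_ `[0, +oo[) t ->
  forall eta, 0 < eta -> exists e, [/\ 0 < e, e <= 1, e <= eta &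
    \int[mu]_(s in `[0, e]) `|f (s + t) - f t| <= eta * e].
Proof.
move=> t0 fi tL eta eta0.
set g := f \_ `[0, +oo[.
have gE s : 0 <= s -> g s = f s.
  by move=> s0; rewrite /g /patch ifT// inE/= in_itv/= s0.
have mg : measurable_fun setT g by have [] := locally_integrable_patch fi.
(* [eta / 2] compensates for the factor 2 between the ball and its right half. *)
have [gfin /cvgr_le/(_ (eta / 2))] := (fine_cvgP _ _).1 tL.
rewrite divr_gt0// => /(_ isT) gle.
near (0 : R)^'+ => e.
have e0 : 0 < e by [].
have dc : (davg g t e <= (eta / 2)%:E)%E.
  rewrite -[leLHS]fineK; last by near: e.
  by rewrite lee_fin; near: e.
exists e; split => //.
- by near: e; exact: nbhs_right_le.
- by near: e; exact: nbhs_right_le.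
have := Rintegral_le_davg e0 mg dc; rewrite mulrA divfK//.
congr (_ <= _); apply: eq_Rintegral => s; rewrite inE/= in_itv/= => /andP[s0 _].
by rewrite !gE// addr_ge0.
Unshelve. all: by end_near. Qed.

End lebesgue_points.

Unset Implicit Arguments.

Theorem corollary4p2 (R : realType) (n : nat) (hn : (1 <= n)%N)
  (q : R) (hq : 1 < q) (F : 'cV[R]_n -> R)
  (F_C1 : continuously_differentiable F)
  (F_convex : convex_function [set: convex_lmodType 'cV[R]_n] F)
  (F_posdef : positive_definite_fun F)
  (x0 : 'cV[R]_n) (u : R -> R) (x : R -> 'cV[R]_n)
  (ux_opt : optimal q F x0 u x) :
  {ae @lebesgue_measure R, forall t : R, 0 <= t ->
    u t = optimal_feedback q F (x t)}.
Proof.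
have F_cont : continuous F.
  by move=> a; apply: differentiable_continuous; exact: F_C1.1.
have [F0 Fpos] := F_posdef.
have F_ge0 a : 0 <= F a.
  by have [->|/Fpos/ltW//] := eqVneq a 0; rewrite F0.
have fin : (cost q F u x < +oo)%E.
  have [v [y [vy]]] := finite_cost_exists hn hq F_cont F_ge0 F0 x0.
  by apply: le_lt_trans; exact: ux_opt.2.
have uL := ux_opt.1.1.
have ui := locally_integrable_signed_power hq uL.
(* The exceptional null set is the complement of the Lebesgue points of the signed power of [u],
   extended by zero to negative times. *)
have := lebesgue_differentiation (locally_integrable_patch ui).
apply: (@filterS _ _ (ae_filter_ringOfSetsType (@lebesgue_measure R))).
move=> t tL t0.
have topt := tail_optimal hq F_cont F_ge0 t0 ux_opt fin.
have := derive_value hn hq F_cont F_ge0 F0 F_convex topt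
  (lebesgue_pt_right t0 ui tL).
rewrite /optimal_feedback => ->.
by rewrite signed_powerN opprK signed_powerK// subr_gt0.
Qed.
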